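(* Let $A$ be a unital $C^*$-algebra with unitary group $U(A)$, regarded as a discrete group. Let $\mathcal{SB}(U(A))$ be the class of all unitary representations $(\mu,H)$ of $U(A)$ such that $(\mu,H)$ is (unitarily equivalent to) a subrepresentation of $(\pi_K,K)$ for some unital Hilbert bimodule $K$ over $A$. (a) $A$ has property $(T)$ if and only if there exist a non-empty finite $F\subseteq U(A)$ and $\epsilon>0$ such that for any unital Hilbert bimodule $K$ over $A$ with $V_{\pi_K}(F,\epsilon)\neq\emptyset$, we have $K^{U(A)}\neq\{0\}$. (b) The following statements are equivalent. (i) $A$ has strong property $(T)$. (ii) There exist a non-empty finite $F\subseteq U(A)$ and $\epsilon>0$ such that for any $(\mu,H)\in\mathcal{SB}(U(A))$ and any $\xi\in V_\mu(F,\epsilon)$, we have $P^{U(A)}_H(\xi)\neq 0$. (iii) There exist a non-empty finite $F\subseteq U(A)$ and $\epsilon>0$ such that for any $(\mu,H)\in\mathcal{SB}(U(A))$ with $V_\mu(F,\epsilon)\neq\emptyset$, we have $H^{U(A)}\neq\{0\}$.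
   Context: A unital Hilbert bimodule over $A$ is a Hilbert space $K$ with commuting unital left and right actions of $A$ coming from a non-degenerate $*$-representation $\mu_K$ of $A\otimes_{\max}A^{\rm op}$, with $\mu_K(a\otimes b^{\rm op})\xi=a\cdot\xi\cdot b$ ($A^{\rm op}$ is the opposite $C^*$-algebra). It defines a unitary representation $\pi_K$ of $U(A)$ on $K$ by $\pi_K(u)\xi=\mu_K(u\otimes(u^* )^{\rm op})\xi=u\cdot\xi\cdot u^*$. For a unitary representation $(\mu,H)$ of $U(A)$, $H^{U(A)}:=\{\xi\in H:\mu(u)\xi=\xi\text{ for all }u\in U(A)\}$, $P^{U(A)}_H:H\to H^{U(A)}$ is the orthogonal projection, and for a non-empty finite $F\subseteq U(A)$ and $\epsilon>0$, $V_\mu(F,\epsilon):=\{\xi\in H:\|\xi\|=1,\ \|\mu(t)\xi-\xi\|<\epsilon\text{ for all }t\in F\}$; $K^{U(A)}$ is taken with respect to $\pi_K$. For a unital Hilbert bimodule $H$ over $A$, $H^A:=\{\xi\in H: a\cdot\xi=\xi\cdot a\text{ for all }a\in A\}$, $P^A_H:H\to H^A$ is the orthogonal projection, and for a non-empty finite $Q\subseteq A$ and $\beta>0$, $V_H(Q,\beta):=\{\xi\in H:\|\xi\|=1,\ \|x\cdot\xi-\xi\cdot x\|<\beta\text{ for all }x\in Q\}$. $A$ has property $(T)$ if there exist a non-empty finite $F\subseteq A$ and $\epsilon>0$ such that for any unital Hilbert bimodule $H$ over $A$, $V_H(F,\epsilon)\neq\emptyset$ implies $H^A\neq\{0\}$.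 $A$ has strong property $(T)$ if for any $\alpha>0$ there exist a non-empty finite $Q\subseteq A$ and $\beta>0$ such that for any unital Hilbert bimodule $H$ over $A$ and any $\xi\in V_H(Q,\beta)$, $\|\xi-P^A_H(\xi)\|<\alpha$. *)

(* Defs.v *)
From HB Require Import structures.
From mathcomp Require Import all_boot all_order all_algebra.
From mathcomp Require Import all_classical all_reals all_analysis.
From mathcomp Require Import complex.

Set Implicit Arguments.
Unset Strict Implicit.
Unset Printing Implicit Defensive.

Import Order.TTheory GRing.Theory Num.Theory.
Import numFieldNormedType.Exports.

Local Open Scope classical_set_scope.
Local Open Scope ring_scope.
Local Open Scope complex_scope.

(* Unital C*-algebras; C is R[i] in the end, and norms take their values in C.
   MathComp's ring structures cannot be joined with [completeNormedModType]
   (and its [algType] would exclude the zero algebra), so the multiplication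
   and the unit are fields of the mixin. *)
HB.mixin Record CompleteNormedModule_isCStarAlgebra (C : numClosedFieldType) A
    of CompleteNormedModule C A := {
  cmul : A -> A -> A ;
  cone : A ;
  star : A -> A ;
  cmulA : associative cmul ;
  cmul1l : left_id cone cmul ;
  cmul1r : right_id cone cmul ;
  cmulDl : left_distributive cmul +%R ;
  cmulDr : right_distributive cmul +%R ;
  cmulZl : forall (c : C) (x y : A), cmul (c *: x) y = c *: cmul x y ;
  cmulZr : forall (c : C) (x y : A), cmul x (c *: y) = c *: cmul x y ;
  starK : involutive star ;
  starD : {morph star : x y / x + y} ;
  starZ : forall (c : C) (x : A), star (c *: x) = Num.conj c *: star x ;
  starM : forall x y : A, star (cmul x y) = cmul (star y) (star x) ;
  norm_cmul_le : forall x y : A, `|cmul x y| <= `|x| * `|y| ;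
  norm_cstar : forall x : A, `|cmul (star x) x| = `|x| ^+ 2
}.

#[short(type="cstarType")]
HB.structure Definition CStarAlgebra (C : numClosedFieldType) :=
  { A of CompleteNormedModule C A & CompleteNormedModule_isCStarAlgebra C A }.

Declare Scope cstar_scope.
Delimit Scope cstar_scope with cstar.
Notation "x ** y" := (cmul x y) (at level 40, left associativity) : cstar_scope.
Local Open Scope cstar_scope.

Lemma star_one (C : numClosedFieldType) (A : cstarType C) : star (@cone _ A) = cone.
Proof. by rewrite -[LHS]cmul1l -[X in X ** _]starK -starM cmul1l starK. Qed.

(* The inner product is linear in its first argument. *)
HB.mixin Record CompleteNormedModule_isHilbert (C : numClosedFieldType) H
    of CompleteNormedModule C H := {
  inner : {dot H for @Num.conj C} ;
  norm_inner : forall x : H, `|x| ^+ 2 = inner x x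
}.

#[short(type="hilbertType")]
HB.structure Definition Hilbert (C : numClosedFieldType) :=
  { H of CompleteNormedModule C H & CompleteNormedModule_isHilbert C H }.

Section Opposite.
Variables (C : numClosedFieldType) (A : cstarType C).

Definition opposite : Type := A.

HB.instance Definition _ := CompleteNormedModule.copy opposite A.

Let mulop (x y : opposite) : opposite := (y : A) ** (x : A).
Let starop (x : opposite) : opposite := star (x : A).

Let mulopA : associative mulop.
Proof. by move=> x y z; rewrite /mulop cmulA. Qed.
Let mulop1l : left_id (@cone C A) mulop.
Proof. exact: (@cmul1r C A). Qed.
Let mulop1r : right_id (@cone C A) mulop.
Proof. exact: (@cmul1l C A). Qed.
Let mulopDl : left_distributive mulop +%R.
Proof. by move=> x y z; exact: (@cmulDr C A). Qed.
Let mulopDr : right_distributive mulop +%R.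
Proof. by move=> x y z; exact: (@cmulDl C A). Qed.
Let mulopZl (c : C) (x y : opposite) : mulop (c *: x) y = c *: mulop x y.
Proof. exact: (@cmulZr C A). Qed.
Let mulopZr (c : C) (x y : opposite) : mulop x (c *: y) = c *: mulop x y.
Proof. exact: (@cmulZl C A). Qed.
Let staropK : involutive starop.
Proof. exact: (@starK C A). Qed.
Let staropD : {morph starop : x y / x + y}.
Proof. exact: (@starD C A). Qed.
Let staropZ (c : C) (x : opposite) : starop (c *: x) = Num.conj c *: starop x.
Proof. exact: (@starZ C A). Qed.
Let staropM (x y : opposite) : starop (mulop x y) = mulop (starop y) (starop x).
Proof. exact: (@starM C A). Qed.
Let norm_mulop_le (x y : opposite) : `|mulop x y| <= `|x| * `|y|.
Proof. by rewrite mulrC; exact: (@norm_cmul_le C A). Qed.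
Let norm_starop (x : opposite) : `|mulop (starop x) x| = `|x| ^+ 2.
Proof.
have normS (y : A) : `|star y| ^+ 2 = `|y ** star y|.
  by rewrite -norm_cstar starK.
have norm_star_le (y : A) : `|y| <= `|star y|.
  have [->|y0] := eqVneq y 0; first by rewrite normr0.
  rewrite -(ler_pM2r (x := `|y|)) ?normr_gt0// -expr2 -norm_cstar.
  exact: norm_cmul_le.
have -> : mulop (starop x) x = (x : A) ** star (x : A) by [].
rewrite -[LHS]normS; congr (_ ^+ 2).
apply/eqP; rewrite eq_le norm_star_le andbT.
by have := norm_star_le (star (x : A)); rewrite starK.
Qed.

HB.instance Definition _ := CompleteNormedModule_isCStarAlgebra.Build C opposite
  mulopA mulop1l mulop1r mulopDl mulopDr mulopZl mulopZr staropK staropD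
  staropZ staropM norm_mulop_le norm_starop.

End Opposite.

(* The maximal tensor product of A and B is the completion of the algebraic
   tensor product, a *-algebra, in its largest C*-norm. *)
Section MaxTensor.
Variables (C : numClosedFieldType) (A B : cstarType C).

(* The elements of D of the form \sum_i t (a_i) (b_i). *)
Definition tensor_span (D : lmodType C) (t : A -> B -> D) : set D :=
  [set x | exists n (a : 'I_n -> A) (b : 'I_n -> B), x = \sum_i t (a i) (b i)].

Definition is_cstar_norm_on (D : cstarType C) (S : set D) (p : D -> C) : Prop :=
  [/\ forall x, S x -> 0 <= p x /\ (p x = 0 -> x = 0),
      forall (c : C) x, S x -> p (c *: x) = `|c| * p x,
      forall x y, S x -> S y -> p (x + y) <= p x + p y,
      forall x y, S x -> S y -> p (x ** y) <= p x * p y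
    & forall x, S x -> p (star x ** x) = p x ^+ 2].

Record maxTensor := MaxTensor {
  mt_alg :> cstarType C ;
  tens : {bilinear A -> B -> mt_alg} ;
  tens1 : tens cone cone = cone ;
  tensM : forall a a' b b',
    tens a b ** tens a' b' = tens (a ** a') (b ** b') ;
  tens_star : forall a b, star (tens a b) = tens (star a) (star b) ;
  (* [tensor_span tens] is the algebraic tensor product: a finite sum of
     tensors vanishes only if every bilinear form vanishes on it. *)
  tens_algebraic : forall n (a : 'I_n -> A) (b : 'I_n -> B),
    \sum_i tens (a i) (b i) = 0 ->
    forall f : {bilinear A -> B -> C | *%R & *%R}, \sum_i f (a i) (b i) = 0 ;
  tens_dense : closure (tensor_span tens) = [set: mt_alg] ;
  tens_max : forall p : mt_alg -> C, is_cstar_norm_on (tensor_span tens) p ->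
    forall x, tensor_span tens x -> p x <= `|x|
}.

End MaxTensor.

Definition linear_span (C : numClosedFieldType) (V : lmodType C) (S : set V) : set V :=
  [set x | exists n (c : 'I_n -> C) (v : 'I_n -> V),
     (forall i, S (v i)) /\ x = \sum_i c i *: v i].

Record starRep (C : numClosedFieldType) (D : cstarType C) (H : hilbertType C) :=
  StarRep {
  srep :> {bilinear D -> H -> H} ;
  srep_bounded : forall d, continuous (srep d) ;
  srepM : forall d d' xi, srep (d ** d') xi = srep d (srep d' xi) ;
  srep_star : forall d xi eta,
    inner (srep d xi) eta = inner xi (srep (star d) eta) ;
  srep_nondegenerate :
    closure (linear_span [set srep z.1 z.2 | z in [set: D * H]]) = [set: H]
}.

Section StarRepTheory.
Variables (C : numClosedFieldType) (D : cstarType C) (H : hilbertType C).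
Variable mu : starRep D H.

Lemma srep1 xi : mu cone xi = xi.
Proof.
pose S := [set x : H | mu cone x - x = 0].
have clS : closed S.
  have cf : continuous (fun x : H => mu cone x - x).
    by move=> x; apply: cvgB; [exact: srep_bounded|exact: cvg_id].
  rewrite (_ : S = (fun x : H => mu cone x - x) @^-1` [set 0]); last by [].
  apply: (closed_comp (fun x _ => cf x)).
  exact: accessible_closed_set1 (hausdorff_accessible (@norm_hausdorff _ _)) _.
have spanS : linear_span [set mu z.1 z.2 | z in [set: D * H]] `<=` S.
  move=> _ [n [c [v [hv ->]]]].
  rewrite /S /= linear_sumr -sumrB big1// => i _.
  have [[d x] _ /= <-] := hv i.
  by rewrite linearZr_LR /= -srepM cmul1l subrr.
have : closure (linear_span [set mu z.1 z.2 | z in [set: D * H]]) xi.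
  by rewrite srep_nondegenerate.
move/(closure_subset spanS); rewrite -(closure_id _).1//.
by move=> /eqP; rewrite subr_eq0 => /eqP.
Qed.
End StarRepTheory.

(* A realization of A \otimes_max A^op, which is unique up to isomorphism, is
   carried along with the representation mu_K. *)
Record hilbertBimodule (C : numClosedFieldType) (A : cstarType C) :=
  HilbertBimodule {
  bim_space :> hilbertType C ;
  bim_tensor : maxTensor A (opposite A) ;
  bim_rep : starRep bim_tensor bim_space
}.

Section Bimodule.
Variables (C : numClosedFieldType) (A : cstarType C) (K : hilbertBimodule A).
Implicit Types (a b : A) (xi : K).

(* mu_K(a \otimes b^op) *)
Definition bimu a b : K -> K :=
  bim_rep K (tens (bim_tensor K) a (b : opposite A)).

Definition lact a xi : K := bimu a cone xi.
Definition ract xi b : K := bimu cone b xi.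

Lemma lact1 xi : lact cone xi = xi.
Proof. by rewrite /lact /bimu tens1 srep1. Qed.

Lemma ract1 xi : ract xi cone = xi.
Proof. by rewrite /ract /bimu tens1 srep1. Qed.

Lemma bimuM a b a' b' xi : bimu a b (bimu a' b' xi) = bimu (a ** a') (b' ** b) xi.
Proof. by rewrite /bimu -srepM tensM. Qed.

Lemma bimuE a b xi : bimu a b xi = ract (lact a xi) b.
Proof. by rewrite /ract /lact bimuM !cmul1l. Qed.

Lemma bimuE' a b xi : bimu a b xi = lact a (ract xi b).
Proof. by rewrite /ract /lact bimuM !cmul1r. Qed.

Lemma lactM a a' xi : lact (a ** a') xi = lact a (lact a' xi).
Proof. by rewrite /lact bimuM cmul1l. Qed.

Lemma ractM xi b b' : ract xi (b ** b') = ract (ract xi b) b'.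
Proof. by rewrite /ract bimuM cmul1l. Qed.

Definition central_vectors : set K := [set xi | forall a, lact a xi = ract xi a].

End Bimodule.

Arguments central_vectors {C A} K.

Section UnitaryGroup.
Variables (C : numClosedFieldType) (A : cstarType C).

Definition is_unitary (u : A) : bool :=
  (star u ** u == cone) && (u ** star u == cone).

Record unitary := Unitary { uval :> A ; uvalP : is_unitary uval }.

HB.instance Definition _ := [isSub for uval].
HB.instance Definition _ := [Choice of unitary by <:].

Lemma starUl (u : unitary) : star (u : A) ** (u : A) = cone.
Proof. by have /andP[/eqP] := uvalP u. Qed.

Lemma starUr (u : unitary) : (u : A) ** star (u : A) = cone.
Proof. by have /andP[_ /eqP] := uvalP u. Qed.

Let unitary1 : is_unitary cone.
Proof. by rewrite /is_unitary star_one cmul1l eqxx. Qed.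

Let unitaryV (u : unitary) : is_unitary (star (u : A)).
Proof. by rewrite /is_unitary starK starUl starUr eqxx. Qed.

Let unitaryM (u v : unitary) : is_unitary ((u : A) ** (v : A)).
Proof.
apply/andP; split; apply/eqP; rewrite starM.
  by rewrite cmulA -(cmulA (star (v : A))) starUl cmul1r starUl.
by rewrite cmulA -(cmulA (u : A)) starUr cmul1r starUr.
Qed.

Definition unitary_one : unitary := Unitary unitary1.
Definition unitary_inv (u : unitary) : unitary := Unitary (unitaryV u).
Definition unitary_mul (u v : unitary) : unitary := Unitary (unitaryM u v).

Let umulA : associative unitary_mul.
Proof. by move=> u v w; apply: val_inj; exact: cmulA. Qed.
Let umul1l : left_id unitary_one unitary_mul.
Proof. by move=> u; apply: val_inj; exact: cmul1l. Qed.
Let umul1r : right_id unitary_one unitary_mul.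
Proof. by move=> u; apply: val_inj; exact: cmul1r. Qed.
Let umulVl : left_inverse unitary_one unitary_inv unitary_mul.
Proof. by move=> u; apply: val_inj; exact: starUl. Qed.
Let umulVr : right_inverse unitary_one unitary_inv unitary_mul.
Proof. by move=> u; apply: val_inj; exact: starUr. Qed.

HB.instance Definition _ := isGroup.Build unitary
  umulA umul1l umul1r umulVl umulVr.

End UnitaryGroup.

Record unitaryRep (C : numClosedFieldType) (G : groupType) := UnitaryRep {
  urep_space :> hilbertType C ;
  urep : G -> {linear urep_space -> urep_space} ;
  urep_inner : forall g xi eta, inner (urep g xi) (urep g eta) = inner xi eta ;
  urep1 : forall xi, urep 1%g xi = xi ;
  urepM : forall g h xi, urep (g * h)%g xi = urep g (urep h xi)
}.

(* The orthogonal projection of xi onto S; it exists whenever S is a closed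
   subspace, so the default value 0 is then never used. *)
Definition orthproj (C : numClosedFieldType) (H : hilbertType C) (S : set H) (xi : H) : H :=
  xget 0 [set p | S p /\ forall s, S s -> inner (xi - p) s = 0].

Arguments orthproj {C H} S xi.

Section PropertyT.
Variable R : realType.
Notation C := R[i].

Section FixedVectors.
Variables (G : groupType) (H : unitaryRep C G).

Definition fixed_vectors : set H := [set xi | forall g, urep H g xi = xi].

Definition almost_fixed (F : set G) (eps : R) : set H :=
  [set xi | `|xi| = 1 /\ forall t, F t -> `|urep H t xi - xi| < eps%:C].

End FixedVectors.

Variable A : cstarType C.

Section ConjRep.
Variable K : hilbertBimodule A.

Definition conj_act (u : unitary A) : K -> K := bimu (u : A) (star (u : A)).

Lemma conj_actE u xi : conj_act u xi = ract (lact (u : A) xi) (star (u : A)).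
Proof. exact: bimuE. Qed.

Let conj_act_linear u : linear (conj_act u).
Proof. by move=> c x y; rewrite /conj_act /bimu linearPr. Qed.

HB.instance Definition _ u :=
  GRing.isLinear.Build C K K *:%R (conj_act u) (conj_act_linear u).

Let conj_act_inner u xi eta :
  inner (conj_act u xi) (conj_act u eta) = inner xi eta.
Proof.
rewrite /conj_act /bimu srep_star tens_star -srepM tensM starUl.
have -> : star (star (u : A) : opposite A) ** (star (u : A) : opposite A) = cone.
  exact: (starUr (unitary_inv u)).
by rewrite tens1 srep1.
Qed.

Let conj_act1 xi : conj_act 1%g xi = xi.
Proof. by rewrite /conj_act /bimu /= star_one tens1 srep1. Qed.

Let conj_actM u v xi : conj_act (u * v)%g xi = conj_act u (conj_act v xi).
Proof. by rewrite /conj_act bimuM /= -starM. Qed.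

Definition conj_rep : unitaryRep C (unitary A) :=
  @UnitaryRep C (unitary A) K conj_act conj_act_inner conj_act1 conj_actM.

End ConjRep.

(* The class SB(U(A)): rho is unitarily equivalent, through W, to the
   restriction of pi_K to a closed invariant subspace S of K. *)
Definition SB (rho : unitaryRep C (unitary A)) : Prop :=
  exists (K : hilbertBimodule A) (S : set K) (W : {linear rho -> K}),
    [/\ [/\ closed S, S 0 & forall (c : C) x y, S x -> S y -> S (c *: x + y)],
        forall u x, S x -> S (urep (conj_rep K) u x),
        range W = S,
        forall x y, inner (W x) (W y) = inner x y
      & forall u x, W (urep rho u x) = urep (conj_rep K) u (W x)].

Definition almost_central (H : hilbertBimodule A) (Q : set A) (beta : R) : set H :=
  [set xi | `|xi| = 1 /\ forall x, Q x -> `|lact x xi - ract xi x| < beta%:C].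

Arguments almost_central : clear implicits.

Definition property_T : Prop :=
  exists (F : set A) (eps : R), [/\ F !=set0, finite_set F, 0 < eps &
    forall H : hilbertBimodule A,
      almost_central H F eps !=set0 -> central_vectors H <> [set 0]].

Definition strong_property_T : Prop :=
  forall alpha : R, 0 < alpha ->
  exists (Q : set A) (beta : R), [/\ Q !=set0, finite_set Q, 0 < beta &
    forall (H : hilbertBimodule A) (xi : H), almost_central H Q beta xi ->
      `|xi - orthproj (central_vectors H) xi| < alpha%:C].

End PropertyT.

Arguments almost_central {R A} H Q beta.
Arguments fixed_vectors {R G} H.
Arguments almost_fixed {R G} H F eps.
Arguments conj_rep {R A} K.

(* Main.v *)
Require Import Defs.
From HB Require Import structures.
From mathcomp Require Import all_boot all_order all_algebra.
From mathcomp Require Import all_classical all_reals all_analysis.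
From mathcomp Require Import complex lra.

(* Every element of A is a linear combination of unitaries, because a
   self-adjoint h of norm less than 1 is the average of the unitaries
   h +- i sqrt (1 - h^2). Hence K^A = K^U(A), and vectors that are almost
   invariant under suitable finitely many unitaries are almost central for a
   given finite subset of A; conversely almost centrality at unitaries is
   almost invariance. This gives (a).
   For (b), (i) => (ii): if H is carried by W onto the invariant closed
   subspace S of K, the projection onto S maps K^U(A) into S^U(A); so if
   P_H(xi) = 0, then W xi is orthogonal to K^A, and strong property (T) with
   alpha = 1 is contradicted.
   (iii) => (i): apply the gap to the orthogonal complement of K^U(A), which
   has no nonzero fixed vector: xi - P(xi) is moved by F as little as xi is, so
   its norm is less than alpha as soon as xi is in V(F, alpha * eps). *)

Set Implicit Arguments.
Unset Strict Implicit.
Unset Printing Implicit Defensive.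

Import Order.TTheory GRing.Theory Num.Theory.
Import numFieldNormedType.Exports.

Local Open Scope classical_set_scope.
Local Open Scope ring_scope.
Local Open Scope complex_scope.
Local Open Scope cstar_scope.

(** * Norms as real numbers, and closed sets by approximation *)

Section RealNorm.
Variables (R : realType) (V : normedModType R[i]).
Implicit Types x y z : V.

(** Norms take their values in R[i]; this copy in R is open to [lra] and [nra]. *)
Definition rnorm x : R := complex.Re `|x|.

Lemma rnormE x : `|x| = (rnorm x)%:C.
Proof. by rewrite /rnorm RRe_real// normr_real. Qed.

Lemma rnorm_ge0 x : 0 <= rnorm x.
Proof. by have := normr_ge0 x; rewrite rnormE ler0c. Qed.

Lemma ler_rnormD x y : rnorm (x + y) <= rnorm x + rnorm y.
Proof. by have := ler_normD x y; rewrite !rnormE -rmorphD lecR. Qed.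

Lemma rnormZ (c : R[i]) x : rnorm (c *: x) = complex.Re `|c| * rnorm x.
Proof.
by apply: complexI; rewrite rmorphM/= -!rnormE normrZ.
Qed.

Lemma rnormN x : rnorm (- x) = rnorm x.
Proof. by rewrite /rnorm normrN. Qed.

Lemma rnorm0 : rnorm 0 = 0.
Proof. by rewrite /rnorm normr0. Qed.

Lemma rnorm0_eq0 x : rnorm x = 0 -> x = 0.
Proof. by move=> x0; apply/normr0_eq0; rewrite rnormE x0. Qed.

Lemma rdistC x y : rnorm (x - y) = rnorm (y - x).
Proof. by rewrite /rnorm distrC. Qed.

Lemma ler_rdistD z x y : rnorm (x - y) <= rnorm (x - z) + rnorm (z - y).
Proof. by have := ler_rnormD (x - z) (z - y); rewrite addrA subrK. Qed.

Lemma rnorm_small_eq0 x : (forall e : R, 0 < e -> rnorm x < e) -> x = 0.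
Proof.
move=> xe; apply: rnorm0_eq0; apply/eqP; rewrite eq_le rnorm_ge0 andbT leNgt.
by apply/negP => /xe; rewrite ltxx.
Qed.

Lemma posC_Re (e : R[i]) : 0 < e -> e = (complex.Re e)%:C /\ 0 < complex.Re e.
Proof.
move=> e0; have eE : e = (complex.Re e)%:C by rewrite RRe_real// gtr0_real.
by split => //; rewrite -ltcR -eE.
Qed.

Lemma closedP (S : set V) : closed S <->
  forall x, (forall e : R, 0 < e -> exists2 s, S s & rnorm (x - s) < e) -> S x.
Proof.
split=> [clS x xS|H x xS].
  apply: clS => B /nbhs_ballP[e /= /posC_Re[eE e0]] eB.
  have [s Ss xs] := xS _ e0; exists s; split => //; apply: eB.
  by rewrite -ball_normE /= rnormE eE ltcR.
apply: H => e e0.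
have [s [Ss xs]] := xS _ (@nbhsx_ballx _ _ x e%:C (etrans (ltcR 0 e) e0)).
by exists s => //; move: xs; rewrite -ball_normE /= rnormE ltcR.
Qed.

End RealNorm.

(** * Completeness and the contraction principle *)

Lemma cauchy_limit (R : realType) (V : completeNormedModType R[i])
    (u : nat -> V) :
  (forall e : R, 0 < e ->
    exists N, forall n, (N <= n)%N -> rnorm (u N - u n) < e) ->
  exists l, forall e : R, 0 < e ->
    exists N, forall n, (N <= n)%N -> rnorm (l - u n) < e.
Proof.
move=> cu; have /cvg_ex[l ul] : cvgn u.
  apply/cauchy_cvgP/cauchy_exP => e /posC_Re[eE e0].
  have [N uN] := cu _ e0; exists (u N); exists N => // n /= Nn.
  by rewrite -ball_normE /= rnormE eE ltcR uN.
exists l => e e0; move/cvgrPdist_lt : ul => /(_ e%:C).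
rewrite ltcR => /(_ e0)[N _ uN]; exists N => n /uN /=.
by rewrite rnormE ltcR.
Qed.

Lemma bounded_contraction_fixpoint (R : realType) (V : completeNormedModType R[i])
    (U : set V) (f : V -> V) (M q : R) :
  closed U -> U !=set0 -> (forall x, U x -> U (f x)) ->
  (forall x y, U x -> U y -> rnorm (x - y) <= M) ->
  0 <= q < 1 ->
  (forall x y, U x -> U y -> rnorm (f x - f y) <= q * rnorm (x - y)) ->
  exists2 p, U p & f p = p.
Proof.
move=> /closedP clU [x0 Ux0] fU UM /andP[q0 q1] fq.
pose y n := iter n f x0.
have Uy n : U (y n) by elim: n => //= n; exact: fU.
(* Both points are n-th iterates of points of [U], whose diameter is at most [M], so no geometric
   series has to be summed. *)
have yq n m : rnorm (y n - y (n + m)%N) <= q ^+ n * M.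
  elim: n => [|n IH]; first by rewrite expr0 mul1r UM.
  rewrite addSn exprS -mulrA (le_trans (fq _ _ (Uy _) (Uy _)))//.
  exact: ler_wpM2l.
have qM e : 0 < e -> exists N, forall n, (N <= n)%N -> q ^+ n * M < e.
  move=> e0; have : (fun n => q ^+ n * M) @ \oo --> 0 * M.
    by apply: cvgMl; apply: cvg_expr; rewrite ger0_norm.
  rewrite mul0r => /cvgrPdist_lt /(_ _ e0)[N _ HN]; exists N => n /HN /=.
  by rewrite sub0r normrN; apply: le_lt_trans; exact: ler_norm.
have [e e0|l yl] := @cauchy_limit _ _ y.
  have [N HN] := qM _ e0; exists N => n Nn.
  by rewrite -(subnKC Nn) (le_lt_trans (yq _ _))// HN.
have Ul : U l.
  by apply: clU => e /yl[N HN]; exists (y N); [exact: Uy|exact: HN].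
exists l => //; apply/eqP; rewrite -subr_eq0; apply/eqP/rnorm_small_eq0 => e e0.
(* The distance from [f l] to [l] is at most q |l - y N| + |y N.+1 - l|, and each term is below e /
   2. *)
have [N HN] := yl (e / 2) ltac:(lra).
have := HN _ (leqnn N); have := HN _ (leqnSn N).
have := fq _ _ Ul (Uy N); have := ler_rdistD (y N.+1) (f l) l.
rewrite (rdistC (y N.+1) l) /=.
have := rnorm_ge0 (l - y N); set a := rnorm (l - _); set b := rnorm (f l - f _).
by set c := rnorm (_ - _); set d := rnorm (_ - _); nra.
Qed.

Lemma scaler_half (R : realType) (V : lmodType R[i]) (x : V) :
  (2^-1 : R)%:C *: (x + x) = x.
Proof.
rewrite scalerDr -scalerDl -rmorphD/= [X in (X)%:C](_ : _ = 1) ?scale1r//.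
by lra.
Qed.

(** * C*-algebras: a square root, and the span of the unitaries *)

Section CStarTheory.
Variables (R : realType) (A : cstarType R[i]).
Implicit Types (x y z : A) (c : R[i]).

Lemma cmulNl x y : (- x) ** y = - (x ** y).
Proof. by rewrite -scaleN1r cmulZl scaleN1r. Qed.

Lemma cmulNr x y : x ** (- y) = - (x ** y).
Proof. by rewrite -scaleN1r cmulZr scaleN1r. Qed.

Lemma cmul0r x : x ** 0 = 0.
Proof. by rewrite -(scale0r 0) cmulZr !scale0r. Qed.

Lemma starN x : star (- x) = - star x.
Proof. by rewrite -scaleN1r starZ rmorphN1 scaleN1r. Qed.

Lemma star0 : star (0 : A) = 0.
Proof. by rewrite -(scale0r 0) starZ rmorph0 !scale0r. Qed.

Lemma starZR (r : R) x : star (r%:C *: x) = r%:C *: star x.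
Proof.
rewrite starZ; congr (_ *: _); apply: conj_Creal.
by apply/complex_realP; exists r.
Qed.

Lemma rnormM_le x y : rnorm (x ** y) <= rnorm x * rnorm y.
Proof. by have := norm_cmul_le x y; rewrite !rnormE -rmorphM lecR. Qed.

Lemma rnorm_star_sqr x : rnorm (star x ** x) = rnorm x ^+ 2.
Proof. by apply: complexI; rewrite rmorphXn/= -!rnormE norm_cstar. Qed.

Lemma rnorm_star x : rnorm (star x) = rnorm x.
Proof.
have le_star y : rnorm y <= rnorm (star y).
  have [y0|y0] := eqVneq (rnorm y) 0; first by rewrite y0 rnorm_ge0.
  rewrite -(ler_pM2r (x := rnorm y)) ?lt_def ?y0 ?rnorm_ge0// -expr2.
  by rewrite -rnorm_star_sqr rnormM_le.
by apply/eqP; rewrite eq_le le_star andbT -{2}(starK x) le_star.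
Qed.

(* [y = 1 - sqrt (1 - h^2)] is the fixed point of [y |-> (h^2 + y^2) / 2]. *)
Lemma cstar_sqrt1m (h : A) : star h = h -> rnorm h < 1 ->
  exists b : A, [/\ star b = b, b ** h = h ** b & b ** b = cone - h ** h].
Proof.
move=> hh h1; pose c := rnorm h ^+ 2.
have c0 : 0 <= c by rewrite sqr_ge0.
have c1 : c < 1 by rewrite /c expr_lt1// rnorm_ge0.
have hE : rnorm (h ** h) = c by rewrite -{1}hh rnorm_star_sqr.
(* Self-adjointness and commutation with [h] are built into [U], so the fixed point inherits them;
   the radius c = |h|^2 makes [f] map [U] to itself and contract by the factor [c]. *)
pose U := [set y : A | [/\ rnorm y <= c, star y = y & y ** h = h ** y]].
pose f y := (2^-1 : R)%:C *: (h ** h + y ** y).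
have rhalf x : rnorm ((2^-1 : R)%:C *: x) = 2^-1 * rnorm x.
  by rewrite rnormZ ger0_norm// ler0c invr_ge0.
have hU0 : U 0.
  split; [by rewrite rnorm0|exact: star0|].
  by rewrite cmul0r -(scale0r 0) cmulZl !scale0r.
have [||||||p [pc ps ph] fp] :=
    @bounded_contraction_fixpoint R A U f (c + c) c.
- apply/closedP => x xU; split.
  + rewrite leNgt; apply/negP => cx.
    have [s [sc _ _] xs] := xU (rnorm x - c) ltac:(lra).
    by have := ler_rnormD (x - s) s; rewrite subrK; lra.
  + apply/eqP; rewrite -subr_eq0; apply/eqP/rnorm_small_eq0 => e e0.
    have [s [_ ss _] xs] := xU (e / 2) ltac:(lra).
    have := ler_rdistD s (star x) x; rewrite -{1}ss -(rnorm_star (_ - x)).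
    have -> : star x - star s = star (x - s) by rewrite starD starN.
    by rewrite !rnorm_star (rdistC s x); lra.
  + apply/eqP; rewrite -subr_eq0; apply/eqP/rnorm_small_eq0 => e e0.
    have h0 : 0 <= rnorm h by exact: rnorm_ge0.
    have [s [_ _ sh] xs] := xU (e / 2) ltac:(lra).
    (* As [s] commutes with [h], the commutator of [x] is that of x - s, of norm at most 2 |h| |x -
       s| < e. *)
    have -> : x ** h - h ** x = (x - s) ** h - h ** (x - s).
      rewrite cmulDl cmulDr cmulNl cmulNr sh opprD opprK addrACA addNr.
      by rewrite addr0.
    have := ler_rnormD ((x - s) ** h) (- (h ** (x - s))); rewrite rnormN.
    have := rnormM_le (x - s) h; have := rnormM_le h (x - s).
    by have := rnorm_ge0 (x - s); nra.
- by exists 0.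
- move=> y [yc ys yh]; split.
  + rewrite /f rhalf; have := ler_rnormD (h ** h) (y ** y); rewrite hE.
    by have := rnormM_le y y; have := rnorm_ge0 y; nra.
  + by rewrite /f starZR starD !starM hh ys.
  + by rewrite /f cmulZl cmulZr cmulDl cmulDr !cmulA -(cmulA y y) yh cmulA yh.
- move=> x y [xc _ _] [yc _ _]; have := ler_rnormD x (- y).
  by rewrite rnormN; lra.
- by rewrite c0.
- move=> x y [xc _ _] [yc _ _]; rewrite /f -scalerBr rhalf.
  (* This factorization of x^2 - y^2 holds even if [x] and [y] do not commute. *)
  have -> : h ** h + x ** x - (h ** h + y ** y) = x ** (x - y) + (x - y) ** y.
    rewrite opprD addrACA subrr add0r cmulDl cmulDr cmulNl cmulNr.
    by rewrite addrA subrK.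
  have := ler_rnormD (x ** (x - y)) ((x - y) ** y).
  have := rnormM_le x (x - y); have := rnormM_le (x - y) y.
  by have := rnorm_ge0 (x - y); nra.
have fp2 : h ** h + p ** p = p + p.
  by rewrite -{3 4}fp -scalerDr scaler_half.
(* The fixed point equation reads h^2 + p^2 = 2 p, that is (1 - p)^2 = 1 - h^2. *)
exists (cone - p); split.
- by rewrite starD starN star_one ps.
- by rewrite cmulDl cmulDr cmulNl cmulNr cmul1l cmul1r ph.
- rewrite cmulDl !cmulDr !cmulNl !cmulNr cmul1l cmul1r opprK.
  have -> : h ** h = p + p - p ** p by rewrite -fp2 addrK.
  by rewrite cmul1l !opprD opprK !addrA.
Qed.

(** Phrasing the span as an induction principle spares the bookkeeping of coefficients in later
    arguments. *)
Lemma unitary_span_ind (P : A -> Prop) :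
  (forall u : unitary A, P u) ->
  (forall x y, P x -> P y -> P (x + y)) ->
  (forall c x, P x -> P (c *: x)) ->
  forall x, P x.
Proof.
move=> Pu PD PZ.
have PH1 h : star h = h -> rnorm h < 1 -> P h.
  move=> hh h1; have [b [bs bh b2]] := cstar_sqrt1m hh h1.
  (* Since [b] commutes with [h], the products of h + i b and h - i b are h^2 + b^2 = 1. *)
  have Ju : Defs.is_unitary (h + 'i%R *: b).
    have sE : star (h + 'i%R *: b) = h - 'i%R *: b.
      by rewrite starD starZ conjCi scaleNr hh bs.
    rewrite /Defs.is_unitary sE; apply/andP; split; apply/eqP;
      rewrite cmulDl !cmulDr ?cmulNl ?cmulNr !cmulZl !cmulZr bh b2 scalerA;
      rewrite -expr2 sqrCi scaleN1r opprK.
      by rewrite addrA addrK addrC subrK.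
    by rewrite addrA addrNK addrC subrK.
  pose u := Unitary Ju.
  have -> : h = (2^-1 : R)%:C *: ((u : A) + (unitary_inv u : A)).
    rewrite /= starD starZ conjCi scaleNr hh bs addrACA subrr addr0.
    by rewrite scaler_half.
  by apply: PZ; apply: PD; exact: Pu.
have PH h : star h = h -> P h.
  move=> hh; pose t := (rnorm h + 1)^-1.
  have h0 := rnorm_ge0 h.
  have t0 : 0 < t by rewrite invr_gt0; lra.
  have -> : h = (t^-1)%:C *: (t%:C *: h).
    by rewrite scalerA -rmorphM mulVf ?gt_eqF// scale1r.
  apply/PZ/PH1; first by rewrite starZR hh.
  rewrite rnormZ ger0_norm ?ler0c ?ltW//= /t mulrC ltr_pdivrMr; lra.
move=> x.
(* Cartesian decomposition, arranged so that x + star x and i (x - star x) are self-adjoint and fall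
   under [PH]. *)
have -> : x = (2^-1 : R)%:C *: (x + star x) +
              (- 'i%R) *: ((2^-1 : R)%:C *: ('i%R *: (x - star x))).
  rewrite [(- 'i%R) *: _]scalerA [_ * (_)%:C]mulrC -scalerA -scalerDr !scalerA.
  rewrite mulNr -expr2 sqrCi opprK.
  rewrite scale1r addrACA subrr addr0 scaler_half//.
apply: PD; first by apply/PZ/PH; rewrite starD starK addrC.
apply/PZ/PZ/PH; rewrite starZ conjCi starD starN starK scaleNr -scalerN.
by rewrite opprD opprK addrC.
Qed.

End CStarTheory.

(** * Orthogonal projections in Hilbert spaces *)

Section HilbertTheory.
Variables (R : realType) (H : hilbertType R[i]).
Implicit Types (x y z s : H) (S : set H).

Lemma innerC x y : inner y x = Num.conj (inner x y).
Proof. by rewrite hermC expr0 mul1r. Qed.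

Lemma inner_eq0C x y : inner x y = 0 -> inner y x = 0.
Proof. by move=> xy; rewrite innerC xy rmorph0. Qed.

Lemma innerDl x y z : inner (x + y) z = inner x z + inner y z.
Proof. exact: linearDl. Qed.

Lemma innerBl x y z : inner (x - y) z = inner x z - inner y z.
Proof. exact: linearBl. Qed.

Lemma innerZl (c : R[i]) x y : inner (c *: x) y = c * inner x y.
Proof. exact: linearZl_LR. Qed.

Lemma rnorm_inner x : (rnorm x ^+ 2)%:C = inner x x.
Proof. by rewrite rmorphXn/= -rnormE norm_inner. Qed.

Lemma parallelogram x y :
  rnorm (x + y) ^+ 2 + rnorm (x - y) ^+ 2 = rnorm x ^+ 2 + rnorm y ^+ 2 +
    (rnorm x ^+ 2 + rnorm y ^+ 2).
Proof.
apply: complexI; rewrite !rmorphD/= !rnorm_inner dnormD dnormB /=.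
by rewrite addrACA subrr addr0.
Qed.

(** Removing from [z] its component along [s] lowers |z|^2 by |inner z s|^2 / inner s s, which
    minimality forces to be 0. *)
Lemma minimizer_orthogonal S z :
  (forall (c : R[i]) s, S s -> rnorm z <= rnorm (z - c *: s)) ->
  forall s, S s -> inner z s = 0.
Proof.
move=> zmin s Ss; have [->|s0] := eqVneq s 0; first by rewrite linear0r.
pose a := inner z s; pose n := inner s s.
have n0 : 0 < n by rewrite dnorm_gt0.
have nJ : Num.conj n = n by rewrite conj_Creal// gtr0_real.
have := zmin (a / n) s Ss.
rewrite -(ler_pXn2r (n := 2)) ?nnegrE ?rnorm_ge0//.
rewrite -lecR !rnorm_inner dnormB dnormZ linearZr_LR /= -/a -/n.
have -> : Num.conj (a / n) * a = `|a| ^+ 2 / n.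
  by rewrite rmorphM/= fmorphV/= nJ mulrAC [_ * a]mulrC -normCK.
have -> : `|a / n| ^+ 2 * n = `|a| ^+ 2 / n.
  rewrite normrM normfV (gtr0_norm n0) exprMn -mulrA; congr (_ * _).
  by rewrite expr2 -mulrA mulVf ?mulr1// gt_eqF.
have -> : Num.conj (`|a| ^+ 2 / n) = `|a| ^+ 2 / n.
  by rewrite conj_Creal// ger0_real// divr_ge0 ?exprn_ge0// ltW.
rewrite opprD addrA addrK lerDl oppr_ge0 => aN.
have : `|a| ^+ 2 / n = 0.
  by apply/eqP; rewrite eq_le aN divr_ge0 ?exprn_ge0// ltW.
move/eqP; rewrite mulf_eq0 invr_eq0 (gt_eqF n0) orbF sqrf_eq0 normr_eq0.
by move/eqP.
Qed.

(** The same triple as in [SB], so the subspace given there can be used directly. *)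
Definition closed_subspace S : Prop :=
  [/\ closed S, S 0 & forall (c : R[i]) x y, S x -> S y -> S (c *: x + y)].

Lemma closed_subspaceB S x y : closed_subspace S -> S x -> S y -> S (x - y).
Proof. by case=> _ _ SP Sx Sy; rewrite addrC -scaleN1r; exact: SP. Qed.

Lemma projection_exists S x : closed_subspace S ->
  exists p, S p /\ forall s, S s -> inner (x - p) s = 0.
Proof.
move=> SS; have [clS S0 SP] := SS.
have SD y z : S y -> S z -> S (y + z).
  by move=> Sy Sz; rewrite -(scale1r y); exact: SP.
have SZ c y : S y -> S (c *: y) by move=> Sy; rewrite -(addr0 (_ *: _)); exact: SP.
pose E := [set rnorm (x - s) ^+ 2 | s in S].
have E0 : has_inf E.
  split; first by exists (rnorm (x - 0) ^+ 2), 0.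
  by exists 0 => _ [s _ <-]; exact: sqr_ge0.
pose d := inf E.
have dE s : S s -> d <= rnorm (x - s) ^+ 2.
  by move=> Ss; apply: ge_inf; [case: E0|exists s].
have /choice[u uE] (n : nat) :
    exists s, S s /\ rnorm (x - s) ^+ 2 < d + n.+1%:R^-1.
  have [|_ [s Ss <-] sd] := @inf_adherent _ E n.+1%:R^-1 _ E0.
    by rewrite invr_gt0 ltr0n.
  by exists s.
(* The midpoint of [u n] and [u m] lies in [S], hence at squared distance at least [d] from [x]; the
   parallelogram law does the rest. *)
have uu n m : rnorm (u n - u m) ^+ 2 <= 2 * (n.+1%:R^-1 + m.+1%:R^-1).
  have [Sn dn] := uE n; have [Sm dm] := uE m.
  have := dE _ (SZ (2^-1)%:C _ (SD _ _ Sn Sm)).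
  have := parallelogram (x - u n) (x - u m).
  have -> : x - u n - (x - u m) = u m - u n.
    by rewrite opprB addrC addrA addrNK.
  rewrite (rdistC (u m)).
  have -> : x - u n + (x - u m) = (2 : R)%:C *: (x - (2^-1)%:C *: (u n + u m)).
    rewrite scalerBr scalerA -rmorphM/= mulfV// scale1r addrACA -opprD.
    by rewrite (rmorph_nat (real_complex R) 2) scaler_nat mulr2n.
  rewrite rnormZ [complex.Re _](_ : _ = 2); last by rewrite ger0_norm// ler0c.
  rewrite exprMn; move: dn dm.
  move: (rnorm (x - u n) ^+ 2) (rnorm (x - u m) ^+ 2) (rnorm (u n - u m) ^+ 2).
  move: (rnorm _ ^+ 2) (n.+1%:R^-1) (m.+1%:R^-1) => a b c e f g.
  by lra.
have small (e : R) : 0 < e -> exists N, forall n, (N <= n)%N -> n.+1%:R^-1 < e.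
  move=> e0; have /cvgrPdist_lt/(_ _ e0)[N _ HN] := @cvg_harmonic R.
  exists N => n /HN /=; rewrite sub0r normrN; apply: le_lt_trans.
  exact: ler_norm.
have [e e0|p pu] := @cauchy_limit _ _ u.
  have [N HN] := small (e ^+ 2 / 4) ltac:(nra).
  exists N => n Nn; have := uu N n; have := HN _ Nn; have := HN _ (leqnn N).
  move=> N1 n1 un; rewrite -(ltr_pXn2r (n := 2)) ?nnegrE ?rnorm_ge0 ?ltW//.
  move: (_ ^+ 2) (N.+1%:R^-1) (n.+1%:R^-1) un N1 n1 => a b c.
  by lra.
have Sp : S p.
  by apply: (closedP S).1 => // e /pu[N HN]; exists (u N); [case: (uE N)|exact: HN].
have pd : rnorm (x - p) ^+ 2 <= d.
  rewrite leNgt; apply/negP => dp.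
  pose a := rnorm (x - p); have a0 : 0 <= a by exact: rnorm_ge0.
  pose g := a ^+ 2 - d; have g0 : 0 < g by rewrite /g; lra.
  (* Then a^2 - |x - u n|^2 <= 2 a e <= g / 2, while |x - u n|^2 < d + g / 4; together they
     contradict a^2 = d + g. *)
  pose e := g / (4 * (a + 1)).
  have e0 : 0 < e by rewrite divr_gt0//; nra.
  have eE : e * (a + 1) = g / 4.
    by rewrite /e invfM mulrA -mulrA mulVf ?mulr1//; lra.
  have [N HN] := pu _ e0; have [M HM] := small (g / 4) ltac:(lra).
  pose n := maxn N M.
  have := HN n (leq_maxl _ _); have := HM n (leq_maxr _ _).
  have [_ un] := uE n; move=> n4 pn.
  have := ler_rdistD (u n) x p; rewrite (rdistC (u n)) -/a.
  move: un n4 pn; have := rnorm_ge0 (x - u n); have := rnorm_ge0 (p - u n).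
  move: (rnorm (x - u n)) (rnorm (p - u n)) (n.+1%:R^-1).
  move=> b t m t0 b0 b2 n4 te ab.
  have : a ^+ 2 - b ^+ 2 <= 2 * a * t.
    by have [ba|ba] := leP a b; nra.
  have : a * t <= a * e by apply: ler_wpM2l => //; exact: ltW.
  by move: g0 eE n4 b2 e0; rewrite mulrDr mulr1 (mulrC e) /g; lra.
exists p; split => //; apply: minimizer_orthogonal => c s Ss.
rewrite -(ler_pXn2r (n := 2)) ?nnegrE ?rnorm_ge0// (le_trans pd)//.
by rewrite -addrA -opprD; apply: dE; apply: SD => //; exact: SZ.
Qed.

Lemma orthprojP S x : closed_subspace S ->
  S (orthproj S x) /\ forall s, S s -> inner (x - orthproj S x) s = 0.
Proof.
move=> /(projection_exists x)[p pP].
exact: (@xgetI _ 0 [set p | S p /\ forall s, S s -> inner (x - p) s = 0] p pP).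
Qed.

(** Orthogonality of [y] to [s0] amounts to |y| <= |y - c s0| for all [c], an inequality of norms
    that passes to limits. *)
Lemma closed_subspace_orthocomplement S :
  closed_subspace [set x : H | forall s, S s -> inner x s = 0].
Proof.
split=> [|s _|c x y Px Py s Ss]; last 2 first.
- by rewrite linear0l.
- by rewrite linearPl /= Px// Py// mulr0 addr0.
apply/closedP => x xP s0 Ss0; apply: (@minimizer_orthogonal [set s0]) => // c _ ->.
rewrite leNgt; apply/negP => xs.
(* Within half the gap of [x], the point [y] would still have |y - c s0| < |y|. *)
have [y yP yx] := xP ((rnorm x - rnorm (x - c *: s0)) / 2) ltac:(lra).
have : rnorm y <= rnorm (y - c *: s0).
  rewrite -(ler_pXn2r (n := 2)) ?nnegrE ?rnorm_ge0// -lecR !rnorm_inner.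
  have yc : inner y (c *: s0) = 0 by rewrite linearZr_LR /= (yP s0 Ss0) mulr0.
  rewrite dnormB yc /= rmorph0 addr0 subr0 lerDl.
  exact: dnorm_ge0.
have := ler_rdistD y x 0; rewrite !subr0.
have := ler_rdistD x y (c *: s0); rewrite (rdistC y x).
by lra.
Qed.

End HilbertTheory.

(** * Unitary representations and their fixed vectors *)

Section UnitaryRepresentations.
Variables (R : realType) (G : groupType) (rho : unitaryRep R[i] G).

Lemma rnorm_urep g (x : rho) : rnorm (urep rho g x) = rnorm x.
Proof.
apply/eqP; rewrite -(eqrXn2 (n := 2)) ?rnorm_ge0//; apply/eqP/complexI.
by rewrite !rnorm_inner urep_inner.
Qed.

Lemma urepK g (x : rho) : urep rho g^-1%g (urep rho g x) = x.
Proof. by rewrite -urepM mulVg urep1. Qed.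

Lemma urep_adj g (x y : rho) :
  inner (urep rho g x) y = inner x (urep rho g^-1%g y).
Proof. by rewrite -(urep_inner g^-1%g) urepK. Qed.

Lemma fixed_vectors_closed_subspace : closed_subspace (fixed_vectors rho).
Proof.
split=> [|g|c x y xf yf g]; last 2 first.
- exact: linear0.
- by rewrite linearP /= xf yf.
apply/closedP => x xP g.
apply/eqP; rewrite -subr_eq0; apply/eqP/rnorm_small_eq0 => e e0.
have [s sf xs] := xP (e / 2) ltac:(lra).
have := ler_rdistD s (urep rho g x) x; rewrite -{1}(sf g) -linearB.
by rewrite rnorm_urep (rdistC s); lra.
Qed.

Lemma almost_fixedP (F : set G) (eps : R) (x : rho) : almost_fixed rho F eps x <->
  rnorm x = 1 /\ forall t, F t -> rnorm (urep rho t x - x) < eps.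
Proof.
split=> -[x1 xF]; split.
- by rewrite /rnorm x1.
- by move=> t /xF; rewrite rnormE ltcR.
- by rewrite rnormE x1.
- by move=> t /xF; rewrite rnormE ltcR.
Qed.

End UnitaryRepresentations.

(** * Bimodules: central vectors against vectors fixed by conjugation *)

Section Bimodules.
Variables (R : realType) (A : cstarType R[i]).

Section Conjugation.
Variable K : hilbertBimodule A.
Implicit Types (a b : A) (x y : K) (u : unitary A).

Lemma lactD a b x : lact (a + b) x = lact a x + lact b x.
Proof. by rewrite /lact /bimu !linearDl. Qed.

Lemma lactZ (c : R[i]) a x : lact (c *: a) x = c *: lact a x.
Proof. by rewrite /lact /bimu !linearZl_LR. Qed.

Lemma ractD x a b : ract x (a + b) = ract x a + ract x b.
Proof. by rewrite /ract /bimu linearDr linearDl. Qed.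

Lemma ractZ x (c : R[i]) a : ract x (c *: a) = c *: ract x a.
Proof. by rewrite /ract /bimu linearZr_LR linearZl_LR. Qed.

Lemma ractB x y a : ract (x - y) a = ract x a - ract y a.
Proof. by rewrite /ract /bimu linearBr. Qed.

Lemma ract_inner u x y : inner (ract x (u : A)) (ract y (u : A)) = inner x y.
Proof.
rewrite /ract /bimu srep_star tens_star -srepM tensM star_one cmul1l.
have -> : star ((u : A) : opposite A) ** ((u : A) : opposite A) = cone.
  exact: (starUr u).
by rewrite tens1 srep1.
Qed.

(** The commutator is the displacement of [x] under conjugation, multiplied on the right by [u],
    which is isometric. *)
Lemma rnorm_commutator u x : rnorm (lact (u : A) x - ract x (u : A)) =
  rnorm (urep (conj_rep K) u x - x).
Proof.
have -> : lact (u : A) x - ract x (u : A) = ract (urep (conj_rep K) u x - x) (u : A).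
  by rewrite ractB [urep _ _ _]conj_actE -ractM starUl ract1.
apply/eqP; rewrite -(eqrXn2 (n := 2)) ?rnorm_ge0//; apply/eqP/complexI.
by rewrite !rnorm_inner ract_inner.
Qed.

Lemma almost_centralP (Q : set A) (beta : R) x : almost_central K Q beta x <->
  rnorm x = 1 /\ forall a, Q a -> rnorm (lact a x - ract x a) < beta.
Proof.
split=> -[x1 xF]; split.
- by rewrite /rnorm x1.
- by move=> t /xF; rewrite rnormE ltcR.
- by rewrite rnormE x1.
- by move=> t /xF; rewrite rnormE ltcR.
Qed.

Lemma central_vectorsE : central_vectors K = fixed_vectors (conj_rep K).
Proof.
apply/seteqP; split=> x xP.
  move=> u; apply/eqP; rewrite -subr_eq0; apply/eqP/rnorm0_eq0.
  by rewrite -rnorm_commutator xP subrr rnorm0.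
apply: unitary_span_ind => [u|a b ax bx|c a ax].
- apply/eqP; rewrite -subr_eq0; apply/eqP/rnorm0_eq0.
  by rewrite rnorm_commutator xP subrr rnorm0.
- by rewrite lactD ractD ax bx.
- by rewrite lactZ ractZ ax.
Qed.

Lemma almost_central_unitary (F : set (unitary A)) (eps : R) :
  almost_central K [set uval u | u in F] eps = almost_fixed (conj_rep K) F eps.
Proof.
apply/seteqP; split=> x.
  move=> /almost_centralP[x1 xF]; apply/almost_fixedP; split=> // u Fu.
  by rewrite -rnorm_commutator; apply: xF; exists u.
move=> /almost_fixedP[x1 xF]; apply/almost_centralP; split=> // _ [u Fu <-].
by rewrite rnorm_commutator; exact: xF.
Qed.

End Conjugation.

(** [F] and [eps] are chosen before [K], so the estimate is uniform over all bimodules. The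
    induction on [a] keeps [beta] general, since sums and scalars change the tolerance. *)
Lemma almost_fixed_commutator (a : A) (beta : R) : 0 < beta ->
  exists (F : set (unitary A)) (eps : R), [/\ finite_set F, 0 < eps &
    forall (K : hilbertBimodule A) (x : K),
      (forall u, F u -> rnorm (urep (conj_rep K) u x - x) < eps) ->
      rnorm (lact a x - ract x a) < beta].
Proof.
move: a beta.
apply: unitary_span_ind => [u|a b IHa IHb|c a IHa] beta beta0.
- exists [set u], beta; split=> // K x xF.
  by rewrite rnorm_commutator; exact: xF.
- have [F [e [Ffin e0 Fe]]] := IHa (beta / 2) ltac:(lra).
  have [G [d [Gfin d0 Gd]]] := IHb (beta / 2) ltac:(lra).
  exists (F `|` G), (Num.min e d); split; first by rewrite finite_setU.
    by rewrite lt_min e0.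
  move=> K x xFG; have := ler_rnormD (lact a x - ract x a) (lact b x - ract x b).
  rewrite addrACA -opprD -lactD -ractD.
  have := Fe K x _; have := Gd K x _; move=> /(_ _)-H1 /(_ _)-H2 H3.
  have {}H1 : rnorm (lact b x - ract x b) < beta / 2.
    by apply: H1 => u Gu; have := xFG u (or_intror Gu); rewrite lt_min => /andP[].
  have {}H2 : rnorm (lact a x - ract x a) < beta / 2.
    by apply: H2 => u Fu; have := xFG u (or_introl Fu); rewrite lt_min => /andP[].
  by lra.
- pose k := complex.Re `|c|.
  have k0 : 0 <= k by rewrite -ler0c /k RRe_real// normr_real.
  (* Dividing by k + 1 instead of [k] covers c = 0. *)
  have [F [e [Ffin e0 Fe]]] := IHa (beta / (k + 1)) ltac:(apply: divr_gt0; lra).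
  exists F, e; split=> // K x /Fe.
  rewrite lactZ ractZ -scalerBr rnormZ -/k ltr_pdivlMr; last by lra.
  have := rnorm_ge0 (lact a x - ract x a).
  by move: (rnorm _) => r; rewrite mulrDr mulr1 (mulrC r); lra.
Qed.

Lemma almost_fixed_sub_almost_central (Q : set A) (beta : R) :
  finite_set Q -> 0 < beta ->
  exists (F : set (unitary A)) (eps : R),
    [/\ F !=set0, finite_set F, 0 < eps & forall K : hilbertBimodule A,
      almost_fixed (conj_rep K) F eps `<=` almost_central K Q beta].
Proof.
move=> /finite_seqP[s ->] beta0.
suff [F [e [F0 Ffin e0 Fe]]] : exists (F : set (unitary A)) (eps : R),
    [/\ F !=set0, finite_set F, 0 < eps & forall (K : hilbertBimodule A) (x : K),
      (forall u, F u -> rnorm (urep (conj_rep K) u x - x) < eps) ->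
      forall a, a \in s -> rnorm (lact a x - ract x a) < beta].
  exists F, e; split=> // K x /almost_fixedP[x1 xF].
  by apply/almost_centralP; split=> // a; exact: Fe.
elim: s => [|a s [F [e [F0 Ffin e0 Fe]]]].
  (* Starting from the identity keeps [F] non-empty even when [Q] is empty. *)
  by exists [set 1%g], 1; split=> //; exists 1%g.
have [G [d [Gfin d0 Gd]]] := almost_fixed_commutator a beta0.
exists (F `|` G), (Num.min e d); split.
- by have [u Fu] := F0; exists u; left.
- by rewrite finite_setU.
- by rewrite lt_min e0.
move=> K x xFG b; rewrite inE => /predU1P[->|].
  by apply: Gd => u Gu; have := xFG u (or_intror Gu); rewrite lt_min => /andP[].
apply: Fe => u Fu.
by have := xFG u (or_introl Fu); rewrite lt_min => /andP[].
Qed.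

End Bimodules.

(** * A closed subspace as a Hilbert space *)

Section SubHilbert.
Variables (R : realType) (H : hilbertType R[i]) (S : set H).
Hypothesis SS : closed_subspace S.

(* The proof argument only serves to infer the submodule structure. *)
Definition sub_pred & closed_subspace S : {pred H} := fun x => `[< S x >].

Let sub_submod : GRing.submod_closed (sub_pred SS).
Proof.
have [_ S0 SP] := SS; split; first by apply/asboolP.
by move=> c x y /asboolP Sx /asboolP Sy; apply/asboolP; exact: SP.
Qed.

HB.instance Definition _ := GRing.isSubmodClosed.Build R[i] H
  (sub_pred SS) sub_submod.

Record sub_hilbert := SubHilbert {
  sub_val :> H ; _ : sub_val \in sub_pred SS }.

HB.instance Definition _ := [isSub for @sub_val].
HB.instance Definition _ := [Choice of sub_hilbert by <:].
HB.instance Definition _ := [SubChoice_isSubLmodule of sub_hilbert by <:].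


Implicit Types x y : sub_hilbert.

Lemma sub_hilbertP x : S (sub_val x).
Proof. by case: x => x /= /asboolP. Qed.

Let sub_norm x : R[i] := `|sub_val x|.

Let sub_normD x y : sub_norm (x + y) <= sub_norm x + sub_norm y.
Proof. exact: ler_normD. Qed.
Let sub_normZ (c : R[i]) x : sub_norm (c *: x) = `|c| * sub_norm x.
Proof. exact: normrZ. Qed.
Let sub_norm0 x : sub_norm x = 0 -> x = 0.
Proof. by move=> /normr0_eq0 x0; exact: val_inj. Qed.

HB.instance Definition _ :=
  Lmodule_isNormed.Build R[i] sub_hilbert sub_normD sub_normZ sub_norm0.

Let sub_inner x y : R[i] := inner (sub_val x) (sub_val y).

(** The image filter converges in [H], and closedness of [S] puts the limit back in [S]. *)
Let sub_complete (F : set_system sub_hilbert) :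
  ProperFilter F -> cauchy F -> cvg F.
Proof.
move=> PF /cauchyP FC; have [clS _ _] := SS.
have /cauchy_cvgP/cvg_ex[l Fl] : cauchy (sub_val @ F).
  apply/cauchyP => e e0; have [x Fx] := FC e e0; exists (sub_val x).
  apply: filterS Fx => y.
  by move=> xy; rewrite /= -ball_normE; exact: xy.
have Sl : l \in sub_pred SS.
  apply/asboolP/clS => B /Fl FB; have /filter_ex[y By] : F (sub_val @^-1` B) := FB.
  by exists (sub_val y); split => //; exact: sub_hilbertP.
apply/cvg_ex; exists (SubHilbert Sl); apply/cvg_ballP => e e0.
move/cvg_ballP : Fl => /(_ e e0); apply: filterS => y.
by rewrite /= -ball_normE => ly; exact: ly.
Qed.

HB.instance Definition _ := Uniform_isComplete.Build sub_hilbert sub_complete.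

Let sub_inner_bilinear : bilinear_for *%R (Num.conj \; *%R) sub_inner.
Proof.
by split=> u c x y; rewrite /sub_inner/= ?linearPl ?linearPr.
Qed.

HB.instance Definition _ := bilinear_isBilinear.Build R[i] sub_hilbert sub_hilbert
  R[i] *%R (Num.conj \; *%R) sub_inner sub_inner_bilinear.

HB.instance Definition _ := isHermitianSesquilinear.Build R[i] sub_hilbert
  false Num.conj sub_inner (fun x y => hermC _ _ _).

Let sub_inner_gt0 x : x != 0 -> 0 < sub_inner x x.
Proof.
move=> x0; rewrite /sub_inner dnorm_gt0; apply: contra_neq x0 => x0.
exact: val_inj.
Qed.

HB.instance Definition _ := isDotProduct.Build R[i] sub_hilbert
  sub_inner sub_inner_gt0.

Let sub_dot : {dot sub_hilbert for Num.conj} := sub_inner.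

Let sub_norm_inner x : `|x| ^+ 2 = sub_dot x x.
Proof. exact: norm_inner. Qed.

HB.instance Definition _ :=
  CompleteNormedModule_isHilbert.Build R[i] sub_hilbert sub_norm_inner.

End SubHilbert.

(** * Subrepresentations and projections of fixed vectors *)

Section SubRepresentation.
Variables (R : realType) (G : groupType) (rho : unitaryRep R[i] G) (S : set rho).
Hypotheses (SS : closed_subspace S)
  (Sinv : forall g x, S x -> S (urep rho g x)).

Let sub_act_subproof g (x : sub_hilbert SS) :
  urep rho g (sub_val x) \in sub_pred SS.
Proof. by apply/asboolP/Sinv; exact: sub_hilbertP. Qed.

Definition sub_act g (x : sub_hilbert SS) : sub_hilbert SS :=
  SubHilbert (sub_act_subproof g x).

Let sub_act_linear g : linear (sub_act g).
Proof. by move=> c x y; apply: val_inj; exact: linearP. Qed.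

HB.instance Definition _ g := GRing.isLinear.Build R[i] (sub_hilbert SS)
  (sub_hilbert SS) *:%R (sub_act g) (sub_act_linear g).

Let sub_act_inner g x y : inner (sub_act g x) (sub_act g y) = inner x y.
Proof. exact: urep_inner. Qed.
Let sub_act1 x : sub_act 1%g x = x.
Proof. by apply: val_inj; exact: urep1. Qed.
Let sub_actM g h x : sub_act (g * h)%g x = sub_act g (sub_act h x).
Proof. by apply: val_inj; exact: urepM. Qed.

Definition sub_rep : unitaryRep R[i] G :=
  @UnitaryRep R[i] G (sub_hilbert SS) sub_act sub_act_inner sub_act1 sub_actM.

End SubRepresentation.

Lemma SB_sub_rep (R : realType) (A : cstarType R[i]) (K : hilbertBimodule A)
    (S : set (conj_rep K)) (SS : closed_subspace S)
    (Sinv : forall u x, S x -> S (urep (conj_rep K) u x)) :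
  SB (sub_rep SS Sinv).
Proof.
pose W : {linear sub_hilbert SS -> conj_rep K} := \val.
exists K, S, W; split=> //.
apply/seteqP; split=> [_ [x _ <-]|x Sx]; first exact: sub_hilbertP.
have Sx' : x \in sub_pred SS by apply/asboolP.
by exists (SubHilbert Sx').
Qed.

(** As [g] fixes [p] and preserves [S], the translate by [g] of the projection is again a projection
    of [p] onto [S]; the two agree because their difference lies in [S] and is orthogonal to [S]. *)
Lemma fixed_orthproj (R : realType) (G : groupType) (rho : unitaryRep R[i] G)
    (S : set rho) (p : rho) : closed_subspace S ->
  (forall g x, S x -> S (urep rho g x)) ->
  fixed_vectors rho p -> fixed_vectors rho (orthproj S p).
Proof.
move=> SS Sinv pf g; have [Sq pq] := orthprojP p SS.
set q := orthproj S p in Sq pq *.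
have Sgq := Sinv g q Sq.
have gqp s : S s -> inner (p - urep rho g q) s = 0.
  by move=> Ss; rewrite -{1}(pf g) -linearB urep_adj pq//; exact: Sinv.
apply/eqP; rewrite -subr_eq0 -(dnorm_eq0 inner); set d := urep rho g q - q.
have Sd : S d by exact: closed_subspaceB.
have {1}-> : d = (p - q) - (p - urep rho g q).
  by rewrite opprB [RHS]addrC addrA subrK.
by rewrite innerBl pq// gqp// subrr.
Qed.

(** * Strong property (T) and the spectral gap conditions *)

Lemma strong_property_T_projection (R : realType) (A : cstarType R[i]) :
  strong_property_T A ->
  exists (F : set (unitary A)) (eps : R),
    [/\ F !=set0, finite_set F, 0 < eps &
      forall H : unitaryRep R[i] (unitary A), SB H ->
      forall xi : H, almost_fixed H F eps xi ->
        orthproj (fixed_vectors H) xi <> 0].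
Proof.
move=> /(_ 1 ltr01)[Q [beta [_ Qfin beta0 QT]]].
have [F [e [F0 Ffin e0 Fe]]] := almost_fixed_sub_almost_central Qfin beta0.
exists F, e; split=> // H [K [S [W [SS Sinv WS Winner Wact]]]] xi.
move=> /almost_fixedP[xi1 xiF] xi0.
have rW x : rnorm (W x) = rnorm x.
  apply/eqP; rewrite -(eqrXn2 (n := 2)) ?rnorm_ge0//; apply/eqP/complexI.
  by rewrite !rnorm_inner Winner.
have [_ xio] := orthprojP xi (fixed_vectors_closed_subspace H).
rewrite xi0 subr0 in xio.
have SW x : S (W x) by rewrite -WS; exists x.
have etaF : almost_fixed (conj_rep K) F e (W xi).
  apply/almost_fixedP; rewrite rW; split=> // u Fu.
  by rewrite -Wact -linearB rW xiF.
have := QT K _ (Fe K _ etaF); rewrite rnormE ltcR central_vectorsE.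
have [pf pP] := orthprojP (W xi) (fixed_vectors_closed_subspace (conj_rep K)).
set p := orthproj _ _ in pf pP *.
have [Sq pq] := orthprojP p SS.
have := @fixed_orthproj R _ (conj_rep K) S p SS Sinv pf.
set q := orthproj S p in Sq pq * => qf.
(* The fixed vector [q] of [S] is pulled back to [H], where [xi] is orthogonal to all fixed
   vectors. *)
have [q' _ qE] : range W q by rewrite WS.
have q'f : fixed_vectors H q'.
  move=> u; apply/eqP; rewrite -subr_eq0; apply/eqP/rnorm0_eq0.
  by rewrite -rW linearB Wact qE qf subrr rnorm0.
(* Split [p] along [S]: p - q is orthogonal to [S], which contains W xi, and q = W q' is orthogonal
   to W xi. *)
have pW : inner p (W xi) = 0.
  have -> : p = (p - q) + q by rewrite subrK.
  by rewrite innerDl pq// add0r -qE Winner; apply/inner_eq0C/xio.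
have : inner p p = 0.
  have := pP p pf; rewrite innerBl (inner_eq0C pW) sub0r.
  by move/eqP; rewrite oppr_eq0 => /eqP.
(* With p = 0 the bound for alpha = 1 reads |W xi| < 1, but W xi is a unit vector. *)
move/eqP; rewrite dnorm_eq0 => /eqP ->.
by rewrite subr0 rW xi1 ltxx.
Qed.

Lemma strong_property_T_of_gap (R : realType) (A : cstarType R[i])
    (F : set (unitary A)) (eps : R) : F !=set0 -> finite_set F -> 0 < eps ->
  (forall H : unitaryRep R[i] (unitary A), SB H ->
    almost_fixed H F eps !=set0 -> fixed_vectors H <> [set 0]) ->
  strong_property_T A.
Proof.
move=> [u0 Fu0] Ffin eps0 FT alpha alpha0.
(* If |eta| >= alpha, normalizing [eta] turns a displacement below alpha * eps into one below
   [eps]. *)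
exists [set uval u | u in F], (alpha * eps); split.
- by exists (uval u0), u0.
- exact: finite_image.
- exact: mulr_gt0.
move=> K xi; rewrite almost_central_unitary central_vectorsE.
move=> /almost_fixedP[_ xiF].
have [pf pP] := orthprojP xi (fixed_vectors_closed_subspace (conj_rep K)).
set p := orthproj _ _ in pf pP *.
set eta : conj_rep K := xi - p; rewrite rnormE ltcR ltNge; apply/negP => eta_ge.
pose S := [set x : conj_rep K |
  forall s, fixed_vectors (conj_rep K) s -> inner x s = 0].
have SS : closed_subspace S by exact: closed_subspace_orthocomplement.
have Sinv u x : S x -> S (urep (conj_rep K) u x).
  by move=> Sx s sf; rewrite urep_adj sf; exact: Sx.
have r0 : 0 < rnorm eta by exact: lt_le_trans eta_ge.
have rV x : rnorm ((rnorm eta)^-1%:C *: x) = (rnorm eta)^-1 * rnorm x.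
  by rewrite rnormZ ger0_norm// ler0c invr_ge0 ltW.
have Szeta : (rnorm eta)^-1%:C *: eta \in sub_pred SS.
  by apply/asboolP => s sf; rewrite innerZl /= pP// mulr0.
apply: (FT _ (SB_sub_rep SS Sinv)).
  exists (SubHilbert Szeta); apply/almost_fixedP; split.
    by rewrite [LHS]rV mulVf// gt_eqF.
  move=> u Fu.
  have -> :
      rnorm (urep (sub_rep SS Sinv) u (SubHilbert Szeta) - SubHilbert Szeta) =
      rnorm (urep (conj_rep K) u ((rnorm eta)^-1%:C *: eta) -
        (rnorm eta)^-1%:C *: eta).
    by [].
  rewrite linearZ /= -scalerBr rV mulrC ltr_pdivrMr//.
  (* The fixed vector [p] cancels. *)
  have -> : urep (conj_rep K) u eta - eta = urep (conj_rep K) u xi - xi.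
    by rewrite /eta linearB /= pf opprB addrA subrK.
  by rewrite (lt_le_trans (xiF u Fu))// mulrC ler_wpM2l// ltW.
(* A fixed vector in [S] is orthogonal to itself. *)
apply/seteqP; split=> [x xf|_ ->]; last by move=> u; exact: linear0.
have xf' : fixed_vectors (conj_rep K) (sub_val x).
  by move=> u; have := congr1 (@sub_val R _ S SS) (xf u).
have /eqP := sub_hilbertP x _ xf'; rewrite dnorm_eq0 => /eqP x0.
exact: val_inj.
Qed.

Theorem theorem6p3 (R : realType) (A : cstarType R[i]) :
  (property_T A <->
    exists (F : set (unitary A)) (eps : R),
      [/\ F !=set0, finite_set F, 0 < eps &
        forall K : hilbertBimodule A,
          almost_fixed (conj_rep K) F eps !=set0 ->
          fixed_vectors (conj_rep K) <> [set 0]])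
  /\
  [<-> strong_property_T A;
       exists (F : set (unitary A)) (eps : R),
         [/\ F !=set0, finite_set F, 0 < eps &
           forall H : unitaryRep R[i] (unitary A), SB H ->
           forall xi : H, almost_fixed H F eps xi ->
             orthproj (fixed_vectors H) xi <> 0];
       exists (F : set (unitary A)) (eps : R),
         [/\ F !=set0, finite_set F, 0 < eps &
           forall H : unitaryRep R[i] (unitary A), SB H ->
             almost_fixed H F eps !=set0 ->
             fixed_vectors H <> [set 0]]].
Proof.
split.
  split=> -[F [e [F0 Ffin e0 FT]]].
    have [G [d [G0 Gfin d0 Gd]]] := almost_fixed_sub_almost_central Ffin e0.
    exists G, d; split=> // K [x xG]; rewrite -central_vectorsE.
    by apply: FT; exists x; exact: Gd.
  have [u Fu] := F0.
  exists [set uval u | u in F], e; split=> //.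
  - by exists (uval u), u.
  - exact: finite_image.
  - by move=> K; rewrite almost_central_unitary central_vectorsE; exact: FT.
tfae.
- exact: strong_property_T_projection.
(* (ii) => (iii): the projection is itself a fixed vector, so it would vanish if 0 were the only
   one. *)
- move=> [F [e [F0 Ffin e0 FT]]]; exists F, e; split=> // H SBH [x xF] H0.
  apply: (FT H SBH x xF).
  have [+ _] := orthprojP x (fixed_vectors_closed_subspace H).
  by rewrite [X in X _ -> _]H0.
- by move=> [F [e [F0 Ffin e0 FT]]]; exact: strong_property_T_of_gap FT.
Qed.
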